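(* Let $N\ge 2$ and let ${}_N\Gamma$ be an (integer) $N$-representable two-particle density matrix. Let $\mathcal{V}$ be an arbitrary subspace of the single-particle Hilbert space, and define the pair $(\rho^{\mathcal V},\Gamma^{\mathcal V})$ by $$\Gamma^{\mathcal V}_{ab;cd}={}_N\Gamma_{ab;cd},\qquad \rho^{\mathcal V}_{ac}=\frac{1}{N-1}\sum_\beta {}_N\Gamma_{a\beta;c\beta},$$ where Latin indices run over an orthonormal basis of $\mathcal V$ and $\beta$ runs over the full orthonormal single-particle basis. Put $\bar N=\mathrm{Tr}\,\rho^{\mathcal V}=\sum_a\rho^{\mathcal V}_{aa}$. Then for every Hamiltonian $\hat H^{\mathcal V}$ with one- and two-body terms defined in the subspace $\mathcal V$, $$\hat H^{\mathcal V}=\sum_{ab}t^{\mathcal V}_{ab}a^\dagger_a a_b+\frac14\sum_{abcd}V^{\mathcal V}_{ab;cd}\,a^\dagger_a a^\dagger_b a_d a_c ,$$ one has $$\mathrm{Tr}\,\rho^{\mathcal V}t^{\mathcal V}+\mathrm{Tr}\,\Gamma^{\mathcal V}V^{\mathcal V}\ \ge\ E_0^{\bar N}\big(\hat H^{\mathcal V}\big).$$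
   Context: Fermionic setting with a finite-dimensional single-particle Hilbert space. Fix an orthonormal basis adapted to $\mathcal V$, i.e. an orthonormal basis of $\mathcal V$ (Latin labels $a,b,c,d$) completed to an orthonormal basis of the whole single-particle space (general elements have Greek labels); $a^\dagger_\alpha,a_\alpha$ are the corresponding creation/annihilation operators. A two-particle density matrix ${}_N\Gamma$ is (integer) $N$-representable if there are normalized $N$-particle fermionic states $|\Psi^N_i\rangle$ and weights $x_i\ge0$, $\sum_i x_i=1$, with ${}_N\Gamma_{\alpha\beta;\gamma\delta}=\sum_i x_i\langle\Psi^N_i|a^\dagger_\alpha a^\dagger_\beta a_\delta a_\gamma|\Psi^N_i\rangle$. The coefficients $t^{\mathcal V}$ are real symmetric; $V^{\mathcal V}$ is real, symmetric under $(ab)\leftrightarrow(cd)$ and antisymmetric under $a\leftrightarrow b$ and under $c\leftrightarrow d$. Traces are $\mathrm{Tr}\,\rho^{\mathcal V}t^{\mathcal V}=\sum_{ac}\rho^{\mathcal V}_{ac}t^{\mathcal V}_{ac}$ and $\mathrm{Tr}\,\Gamma^{\mathcal V}V^{\mathcal V}=\frac14\sum_{abcd}\Gamma^{\mathcal V}_{ab;cd}V^{\mathcal V}_{ab;cd}$. $E_0^{\bar N}(\hat H^{\mathcal V})$, for real $\bar N$, is the ground-state energy for ensembles with average particle number $\bar N$ in the Fock space generated by $\mathcal V$: the minimum of $\sum_{n,i}x^i_n\langle\Psi^n_i|\hat H^{\mathcal V}|\Psi^n_i\rangle$ over all ensembles of normalized $n$-particle states $|\Psi^n_i\rangle$ in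 the fermionic Fock space of $\mathcal V$ ($n=0,1,2,\ldots$) with weights $x^i_n\ge0$, $\sum_{n,i}x^i_n=1$ and $\sum_{n,i}n\,x^i_n=\bar N$. *)

(* Defs.v *)
From HB Require Import structures.
From mathcomp Require Import all_boot all_order all_algebra.
From mathcomp Require Export sesquilinear spectral.
From mathcomp Require Export reals complex.
Set Implicit Arguments.
Unset Strict Implicit.
Unset Printing Implicit Defensive.
Import Order.TTheory GRing.Theory Num.Theory.
Local Open Scope complex_scope.
Local Open Scope sesquilinear_scope.
Local Open Scope ring_scope.

(** The single-particle space is C^d (row vectors, Hermitian inner product
    [u *m v^t*]).  Its fermionic Fock space is realised in the occupation-number
    representation: an index of a ket is (through [enum_val]) the set of occupied
    reference modes, mode k being the k-th canonical basis vector of C^d. *)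
Notation ket R d := ('cV[R[i]]_#|{set 'I_d}|).
Notation fock_op R d := ('M[R[i]]_#|{set 'I_d}|).

Section FockSpace.
Context {R : realType} {d : nat}.
Implicit Types (psi : ket R d) (A : fock_op R d) (u : 'rV[R[i]]_d).

Definition vacuum : ket R d := delta_mx (enum_rank set0) 0.

(* c_k |S> = (-1)^#{j in S | j < k} |S \ {k}> if k is in S, and 0 otherwise. *)
Definition mode_ann (k : 'I_d) : fock_op R d :=
  \matrix_(i, j)
    let T : {set 'I_d} := enum_val i in
    let S : {set 'I_d} := enum_val j in
    if (k \in S) && (T == S :\ k)
    then (-1) ^+ #|[set l in S | (l < k)%N]| else 0.

(* Antilinear in u, so that its adjoint [cre u] is linear in u and
   [cre u *m vacuum] is the one-particle state u. *)
Definition ann u : fock_op R d := \sum_(k < d) (u 0 k)^* *: mode_ann k.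
Definition cre u : fock_op R d := (ann u)^t*.

Definition expect A psi : R[i] := (psi^t* *m A *m psi) 0 0.

Definition normalized psi := psi^t* *m psi = 1%:M.

Definition n_particle (n : nat) psi :=
  forall i, #|(enum_val i : {set 'I_d})| != n -> psi i 0 = 0.

(** The Fock space generated by the row space of V, as a subspace of the whole
    Fock space: the span of all a^+(v_1) ... a^+(v_n) |vac> with v_i in V. *)
Inductive in_fock (V : 'M[R[i]]_d) : ket R d -> Prop :=
| in_fock_vac : in_fock V vacuum
| in_fock_cre u psi : (u <= V)%MS -> in_fock V psi -> in_fock V (cre u *m psi)
| in_fock_add psi phi : in_fock V psi -> in_fock V phi -> in_fock V (psi + phi)
| in_fock_scale (z : R[i]) psi : in_fock V psi -> in_fock V (z *: psi).

Definition weights k (x : 'I_k -> R) :=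
  (forall i, 0 <= x i) /\ \sum_(i < k) x i = 1.

(* The rows of U are the orthonormal single-particle basis. *)
Definition N_representable (U : 'M[R[i]]_d) (N : nat)
    (G : 'I_d -> 'I_d -> 'I_d -> 'I_d -> R[i]) :=
  exists (k : nat) (x : 'I_k -> R) (psi : 'I_k -> ket R d),
    [/\ weights x,
        forall i, normalized (psi i) /\ n_particle N (psi i) &
        forall al be ga de, G al be ga de =
          \sum_(i < k) (x i)%:C *
            expect (cre (row al U) *m cre (row be U)
                    *m ann (row de U) *m ann (row ga U)) (psi i)].

(* e is the energy of some ensemble in the Fock space of V whose average
   particle number is Nbar. *)
Definition ensemble_energy (V : 'M[R[i]]_d) (H : fock_op R d) (Nbar e : R) :=
  exists (k : nat) (n : 'I_k -> nat) (x : 'I_k -> R) (psi : 'I_k -> ket R d),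
    [/\ weights x,
        forall i, [/\ in_fock V (psi i), normalized (psi i)
                    & n_particle (n i) (psi i)],
        \sum_(i < k) x i * (n i)%:R = Nbar &
        \sum_(i < k) (x i)%:C * expect H (psi i) = e%:C].

Definition ground_energy (V : 'M[R[i]]_d) (H : fock_op R d) (Nbar E0 : R) :=
  ensemble_energy V H Nbar E0 /\
  forall e, ensemble_energy V H Nbar e -> E0 <= e.

End FockSpace.

Section Subspace.
Context {R : realType} {r d : nat}.

(* The rows of B are the orthonormal basis of the subspace. *)
Definition hamiltonian (B : 'M[R[i]]_(r, d)) (t : 'M[R]_r)
    (v : 'I_r -> 'I_r -> 'I_r -> 'I_r -> R) : fock_op R d :=
  \sum_a \sum_b (t a b)%:C *: (cre (row a B) *m ann (row b B))
  + 4^-1 *: \sum_a \sum_b \sum_c \sum_e (v a b c e)%:C *: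
      (cre (row a B) *m cre (row b B) *m ann (row e B) *m ann (row c B)).

Definition two_body_sym (v : 'I_r -> 'I_r -> 'I_r -> 'I_r -> R) :=
  forall a b c e, [/\ v a b c e = v c e a b, v b a c e = - v a b c e
                    & v a b e c = - v a b c e].

Definition Tr1 (rho : 'M[R[i]]_r) (t : 'M[R]_r) : R[i] :=
  \sum_a \sum_c rho a c * (t a c)%:C.

Definition Tr2 (G : 'I_r -> 'I_r -> 'I_r -> 'I_r -> R[i])
    (v : 'I_r -> 'I_r -> 'I_r -> 'I_r -> R) : R[i] :=
  4^-1 * \sum_a \sum_b \sum_c \sum_e G a b c e * (v a b c e)%:C.

End Subspace.

(** Labels 'I_(r + s): the first r (Latin, [lshift s a]) index the orthonormal
    basis of the r-dimensional subspace, the others complete it. *)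
Section Restriction.
Context {R : realType} {r s : nat}.
Implicit Type G : 'I_(r + s) -> 'I_(r + s) -> 'I_(r + s) -> 'I_(r + s) -> R[i].

Definition sub_Gamma G (a b c e : 'I_r) : R[i] :=
  G (lshift s a) (lshift s b) (lshift s c) (lshift s e).

Definition sub_rho (N : nat) G : 'M[R[i]]_r :=
  \matrix_(a, c)
    ((N%:R - 1)^-1 * \sum_(be < r + s) G (lshift s a) be (lshift s c) be).

End Restriction.

(* Main.v *)
Require Import Defs.
From mathcomp Require Import all_boot all_order all_algebra ring lra.
Set Implicit Arguments.
Unset Strict Implicit.
Unset Printing Implicit Defensive.
Import Order.TTheory GRing.Theory Num.Theory.
Local Open Scope complex_scope.
Local Open Scope sesquilinear_scope.
Local Open Scope ring_scope.

(** By the anticommutation relations the trace of the reduced pair against H is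
    the expectation of H in the N-particle ensemble, and Nbar that of the number
    operator of V.  For an environment mode b (orthogonal to V), every A built
    from modes of V commutes with b and b^+, so
      <psi|A|psi> = <b psi|A|b psi> + <b b^+ psi|A|b b^+ psi>,
    where both vectors are killed by b and have a definite particle number.
    Doing this for each environment mode replaces psi by finitely many vectors
    killed by all of them, i.e. vectors of the Fock space of V, with the same
    expectation of 1, H and the number operator: an ensemble admissible for
    E_0^Nbar.  The minimum E_0^Nbar is attained: in a joint eigenbasis of H, of
    the total number operator and of the projection onto the Fock space of V,
    it is a linear program with finitely many nonnegative weights and two
    equality constraints, which has a minimiser supported on two points. *)

(** * Algebra of the conjugate transpose *)

Section Adjoint.
Context {C : numClosedFieldType}.

Lemma adjmxM m n p (A : 'M[C]_(m, n)) (B : 'M[C]_(n, p)) :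
  (A *m B)^t* = B^t* *m A^t*.
Proof. by rewrite trmx_mul map_mxM. Qed.

Lemma adjmxD m n (A B : 'M[C]_(m, n)) : (A + B)^t* = A^t* + B^t*.
Proof. by rewrite linearD /= map_mxD. Qed.

Lemma adjmxZ m n a (A : 'M[C]_(m, n)) : (a *: A)^t* = a^* *: A^t*.
Proof. by rewrite linearZ /= map_mxZ. Qed.

Lemma adjmx_sum m n I (r : seq I) (P : pred I) (F : I -> 'M[C]_(m, n)) :
  (\sum_(i <- r | P i) F i)^t* = \sum_(i <- r | P i) (F i)^t*.
Proof. by rewrite linear_sum /= map_mx_sum. Qed.

Lemma adjmx1 n : (1%:M : 'M[C]_n)^t* = 1%:M.
Proof. by rewrite trmx1 map_mx1. Qed.

End Adjoint.

(** * Anticommutation relations of the reference modes *)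

Section Modes.
Context {R : realType} {d : nat}.
Implicit Types (S : {set 'I_d}) (k l : 'I_d).
Local Notation C := R[i].

Definition basket S : ket R d := delta_mx (enum_rank S) 0.

Definition jwsign k S : C := (-1) ^+ #|[set l in S | (l < k)%N]|.

Lemma jwsign_sqr k S : jwsign k S * jwsign k S = 1.
Proof. by rewrite -expr2 -exprM mulnC exprM sqrrN !expr1n. Qed.

Lemma jwsignU1 k l S :
  l \notin S -> jwsign k (l |: S) = (-1) ^+ (l < k)%N * jwsign k S.
Proof.
move=> lS; rewrite /jwsign -exprD; congr (_ ^+ _).
case: ltnP => lk /=.
  have -> : [set x in l |: S | (x < k)%N] = l |: [set x in S | (x < k)%N].
    apply/setP => x; rewrite !inE.
    by case: eqP => // ->; rewrite lk.
  by rewrite cardsU1 !inE (negPf lS).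
rewrite add0n; apply: eq_card => x; rewrite !inE.
by case: eqP => // ->; rewrite ltnNge lk !andbF.
Qed.

Lemma jwsignD1 k l S :
  l \in S -> jwsign k (S :\ l) = (-1) ^+ (l < k)%N * jwsign k S.
Proof.
move=> lS; rewrite -{2}(setD1K lS) jwsignU1 ?setD11 //.
by rewrite mulrA -expr2 sqrr_sign mul1r.
Qed.

(** Exactly one of two distinct modes precedes the other. This single asymmetry is the source of
    every minus sign in the anticommutation relations below. *)
Lemma sign_ltn k l : k != l -> (-1) ^+ (l < k)%N = - (-1) ^+ (k < l)%N :> C.
Proof.
rewrite neq_ltn => /orP[] h; rewrite h ltnNge ltnW //= ?expr1 ?expr0 //.
by rewrite opprK.
Qed.

Lemma mode_ann_basket k S :
  mode_ann k *m basket S =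
  (if k \in S then jwsign k S else 0) *: basket (S :\ k).
Proof.
rewrite -colE; apply/colP => i; rewrite !mxE enum_rankK eqxx andbT.
rewrite -(inj_eq enum_val_inj) enum_rankK.
rewrite /=; case: (k \in S) => /=; last by rewrite mul0r.
by case: eqP => _; rewrite ?mulr1 ?mulr0.
Qed.

Lemma mode_cre_basket k S :
  (mode_ann k)^t* *m basket S =
  (if k \in S then 0 else jwsign k S) *: basket (k |: S).
Proof.
rewrite -colE; apply/colP => i; rewrite !mxE enum_rankK eqxx andbT.
rewrite -(inj_eq enum_val_inj) enum_rankK.
set T : {set 'I_d} := enum_val i.
rewrite /=; case: (boolP (k \in S)) => kS.
  rewrite mul0r; case: ifP; last by rewrite conjC0.
  by case/andP => _ /eqP ST; move: kS; rewrite ST setD11.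
have -> : (k \in T) && (S == T :\ k) = (T == k |: S).
  apply/andP/eqP => [[kT /eqP->]|->]; first by rewrite setD1K.
  by rewrite setU11 setU1K.
case: eqP => [TE|_]; last by rewrite conjC0 mulr0.
(* The transposed matrix entry carries the sign of [k |: S], which equals that of [S] because [k]
   does not precede itself. *)
rewrite rmorphXn rmorphN1 mulr1 TE.
by rewrite -/(jwsign k _) jwsignU1 // ltnn mul1r.
Qed.

Lemma fock_op_ext (A B : fock_op R d) :
  (forall S, A *m basket S = B *m basket S) -> A = B.
Proof.
move=> AB; apply/matrixP => i j.
by have /matrixP/(_ i 0) := AB (enum_val j); rewrite /basket enum_valK -!colE !mxE.
Qed.

Lemma ket_sum_basket (psi : ket R d) :
  psi = \sum_j psi j 0 *: basket (enum_val j).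
Proof.
rewrite {1}[psi]matrix_sum_delta; apply: eq_bigr => j _.
by rewrite big_ord1 /basket enum_valK.
Qed.

Lemma mode_ann_anticomm k l :
  mode_ann k *m mode_ann l = - (mode_ann l *m mode_ann k) :> fock_op R d.
Proof.
apply: fock_op_ext => S; rewrite mulNmx -!mulmxA !mode_ann_basket -!scalemxAr.
rewrite !mode_ann_basket !scalerA !in_setD1 -scaleNr.
have -> : S :\ l :\ k = S :\ k :\ l by apply/setP=> x; rewrite !inE andbCA.
congr (_ *: _); have [->|kl] := eqVneq k l.
  by rewrite /= !mulr0 oppr0.
rewrite /=; case: (boolP (l \in S)) => lS; last by rewrite mul0r mulr0 oppr0.
case: (boolP (k \in S)) => kS; last by rewrite mul0r mulr0 oppr0.
rewrite !jwsignD1 // (sign_ltn kl); ring.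
Qed.

Lemma mode_ann_cre k l :
  mode_ann k *m (mode_ann l)^t* + (mode_ann l)^t* *m mode_ann k
  = (k == l)%:R%:M :> fock_op R d.
Proof.
apply: fock_op_ext => S; rewrite mulmxDl -!mulmxA mode_ann_basket mode_cre_basket.
rewrite -!scalemxAr mode_ann_basket mode_cre_basket !scalerA mul_scalar_mx.
rewrite !inE; have [->|kl] := eqVneq k l.
  case: (boolP (l \in S)) => lS /=.
    by rewrite mul0r scale0r add0r jwsignD1 // ltnn mul1r jwsign_sqr setD1K.
  by rewrite jwsignU1 // ltnn mul1r jwsign_sqr setU1K // mul0r scale0r addr0.
rewrite /= scale0r.
case: (boolP (l \in S)) => lS; first by rewrite mul0r mulr0 !scale0r addr0.
case: (boolP (k \in S)) => kS; last by rewrite mul0r mulr0 !scale0r addr0.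
have -> : (l |: S) :\ k = l |: S :\ k.
  apply/setP => x; rewrite !inE; case: (eqVneq x l) => // ->.
  by rewrite eq_sym kl.
rewrite -scalerDl jwsignU1 // jwsignD1 // (sign_ltn kl).
suff -> : forall a b c : C, a * (- b * c) + c * (b * a) = 0 by rewrite scale0r.
by move=> a b c; ring.
Qed.

End Modes.

(** * Anticommutation relations for arbitrary modes, and the number operator *)

Section Car.
Context {R : realType} {d : nat}.
Local Notation C := R[i].
Implicit Types (u w : 'rV[C]_d) (k l : 'I_d) (S : {set 'I_d}) (psi : ket R d).

Lemma creE u : cre u = \sum_k u 0 k *: (mode_ann k)^t*.
Proof.
rewrite /cre /ann adjmx_sum; apply: eq_bigr => k _.
by rewrite adjmxZ; congr (_ *: _); apply: conjcK.
Qed.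

Lemma annK u : (cre u)^t* = ann u.
Proof. exact: trmxCK. Qed.

Lemma ann_delta k : ann (delta_mx 0 k) = mode_ann k :> fock_op R d.
Proof.
rewrite /ann (bigD1 k) //= big1 ?addr0 => [|l /negPf lk].
  by rewrite !mxE !eqxx rmorph1 scale1r.
by rewrite !mxE lk andbF rmorph0 scale0r.
Qed.

Lemma cre_mulmx m (w : 'rV[C]_m) (A : 'M[C]_(m, d)) :
  cre (w *m A) = \sum_k w 0 k *: cre (row k A).
Proof.
under eq_bigr => k _ do rewrite creE scaler_sumr.
rewrite exchange_big creE /=; apply: eq_bigr => l _; rewrite mxE scaler_suml.
by apply: eq_bigr => k _; rewrite scalerA mxE.
Qed.

Lemma ann_anticomm u w : ann u *m ann w = - (ann w *m ann u).
Proof.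
rewrite /ann !mulmx_suml.
under eq_bigr => k _ do rewrite mulmx_sumr.
rewrite exchange_big -sumrN /=; apply: eq_bigr => l _.
rewrite mulmx_sumr -sumrN; apply: eq_bigr => k _.
rewrite -!scalemxAl -!scalemxAr mode_ann_anticomm !scalerN !scalerA.
by rewrite mulrC.
Qed.

Lemma cre_anticomm u w : cre u *m cre w = - (cre w *m cre u).
Proof.
by rewrite /cre -!adjmxM ann_anticomm linearN /= map_mxN.
Qed.

(** Expanding both operators in reference modes, only equal indices survive, and they sum to the
    inner product of [w] with [u]. *)
Lemma ann_cre u w :
  ann u *m cre w + cre w *m ann u = ((w *m u^t*) 0 0)%:M.
Proof.
rewrite /ann creE !mulmx_suml.
under [X in _ + X]eq_bigr => k _ do rewrite mulmx_sumr.
rewrite [X in _ + X]exchange_big -big_split /= mxE rmorph_sum /=.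
apply: eq_bigr => k _; rewrite mulmx_sumr -big_split /= (bigD1 k) //=.
rewrite big1 ?addr0 => [|l /negPf lk].
  rewrite -!scalemxAl -!scalemxAr !scalerA [w 0 k * _]mulrC -scalerDr.
  by rewrite mode_ann_cre eqxx scale_scalar_mx mulr1 !mxE mulrC.
rewrite -!scalemxAl -!scalemxAr !scalerA [w 0 l * _]mulrC -scalerDr.
by rewrite mode_ann_cre eq_sym lk scale_scalar_mx mulr0 raddf0.
Qed.

Lemma ann_vacuum u : ann u *m vacuum = 0.
Proof.
rewrite /ann mulmx_suml big1 // => k _.
by rewrite -scalemxAl mode_ann_basket inE scale0r scaler0.
Qed.

Definition number_op : fock_op R d :=
  diag_mx (\row_i #|(enum_val i : {set 'I_d})|%:R).

Lemma number_opE n (A : 'M_(_, n)) i j :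
  (number_op *m A) i j = #|(enum_val i : {set 'I_d})|%:R * A i j.
Proof. by rewrite mul_diag_mx !mxE. Qed.

Lemma mul_number_opE n (A : 'M_(n, _)) i j :
  (A *m number_op) i j = #|(enum_val j : {set 'I_d})|%:R * A i j.
Proof. by rewrite mul_mx_diag !mxE mulrC. Qed.

(** Turns the condition on coordinates into an eigenvector equation, so that particle numbers can be
    tracked by commuting operators with [number_op]. *)
Lemma n_particleP n psi :
  n_particle n psi <-> number_op *m psi = n%:R *: psi.
Proof.
split=> [np|np i /negPf cn].
  apply/colP => i; rewrite number_opE mxE.
  by have [->//|/np->] := eqVneq #|(enum_val i : {set 'I_d})| n; rewrite !mulr0.
move/matrixP/(_ i 0): np; rewrite number_opE mxE => /eqP.
rewrite -subr_eq0 -mulrBl mulf_eq0 subr_eq0 eqr_nat cn /=.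
by move/eqP.
Qed.

Lemma number_opJ : number_op^t* = number_op.
Proof.
rewrite /number_op tr_diag_mx map_diag_mx; congr diag_mx.
by apply/rowP => i; rewrite !mxE rmorph_nat.
Qed.

Lemma mode_ann_shift k i j : mode_ann k i j != 0 :> C ->
  #|(enum_val j : {set 'I_d})| = #|(enum_val i : {set 'I_d})|.+1.
Proof.
rewrite mxE /=; case: ifP => [|_]; last by rewrite eqxx.
by case/andP => kS /eqP-> _; rewrite [LHS](cardsD1 k) kS.
Qed.

Lemma number_op_ann u : number_op *m ann u = ann u *m number_op - ann u.
Proof.
rewrite /ann mulmx_sumr mulmx_suml -sumrB; apply: eq_bigr => k _.
rewrite -scalemxAl -scalemxAr -scalerBr; congr (_ *: _).
apply/matrixP => i j; rewrite number_opE [RHS]mxE mul_number_opE [X in _ = _ + X]mxE.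
have [->|/mode_ann_shift->] := eqVneq (mode_ann k i j : C) 0.
  by rewrite !mulr0 subr0.
by rewrite -natr1 mulrDl mul1r addrK.
Qed.

Lemma number_op_cre u : number_op *m cre u = cre u *m number_op + cre u.
Proof.
have := congr1 (fun A : fock_op R d => A^t*) (number_op_ann u).
rewrite adjmxM number_opJ -/(cre u) => ->.
by rewrite linearB /= map_mxB -/(cre u) adjmxM number_opJ subrK.
Qed.

(** The truncated predecessor is harmless: for [n = 0] the vector [ann u *m psi] is zero. *)
Lemma n_particle_ann n u psi :
  n_particle n psi -> n_particle n.-1 (ann u *m psi).
Proof.
move=> np i ni; rewrite /ann mulmx_suml summxE big1 // => k _.
rewrite -scalemxAl mxE [X in _ * X]mxE big1 ?mulr0 // => j _.
have [->|/mode_ann_shift S] := eqVneq (mode_ann k i j : C) 0; first by rewrite mul0r.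
by rewrite np ?mulr0 // S; apply: contraNneq ni => <-.
Qed.

Lemma n_particleZ n (a : C) psi : n_particle n psi -> n_particle n (a *: psi).
Proof. by move=> np i /np p0; rewrite mxE p0 mulr0. Qed.

Lemma number_op_modes : number_op = \sum_k (mode_ann k)^t* *m mode_ann k.
Proof.
apply: fock_op_ext => S; rewrite mulmx_suml.
have /n_particleP np : n_particle #|S| (basket S : ket R d).
  move=> i iS; rewrite mxE -(inj_eq enum_val_inj) enum_rankK.
  by move: iS; case: (_ =P S) => // ->; rewrite !eqxx.
rewrite np -sum1_card natr_sum scaler_suml [RHS](bigID (mem S)) /= [X in _ + X]big1.
  rewrite addr0; apply: eq_bigr => k kS; rewrite scale1r.
  rewrite -mulmxA mode_ann_basket kS -scalemxAr mode_cre_basket setD11 scalerA.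
  by rewrite jwsignD1 // ltnn mul1r jwsign_sqr scale1r setD1K.
by move=> k /negPf kS; rewrite -mulmxA mode_ann_basket kS scale0r mulmx0.
Qed.

(** Basis independence of the number operator: the coefficient of each pair of reference modes is an
    entry of the product of the adjoint of [U] with [U], that is, of the identity. *)
Lemma number_op_unitary (U : 'M[C]_d) : U \is unitarymx ->
  number_op = \sum_k cre (row k U) *m ann (row k U).
Proof.
move=> /unitarymxP/mulmx1C UU; rewrite number_op_modes.
under [RHS]eq_bigr => k _ do rewrite creE mulmx_suml.
rewrite exchange_big /=; apply: eq_bigr => i _.
under [RHS]eq_bigr => k _ do rewrite /ann mulmx_sumr.
rewrite exchange_big /= (bigD1 i) //= [X in _ = _ + X]big1 ?addr0.
  under eq_bigr => k _ do rewrite -scalemxAl -scalemxAr scalerA.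
  rewrite -scaler_suml; move/matrixP/(_ i i): UU; rewrite !mxE eqxx mulr1n.
  under eq_bigr => k _ do rewrite !mxE mulrC.
  by under [X in X *: _]eq_bigr => k _ do rewrite !mxE; move=> ->; rewrite scale1r.
move=> j ji.
under eq_bigr => k _ do rewrite -scalemxAl -scalemxAr scalerA.
rewrite -scaler_suml; move/matrixP/(_ j i): UU; rewrite !mxE (negPf ji).
under eq_bigr => k _ do rewrite !mxE mulrC.
by under [X in X *: _]eq_bigr => k _ do rewrite !mxE; move=> ->; rewrite scale0r.
Qed.

Lemma ann_cre_unitary (U : 'M[C]_d) j k : U \is unitarymx ->
  ann (row j U) *m cre (row k U) + cre (row k U) *m ann (row j U)
  = (k == j)%:R%:M.
Proof.
move=> /unitarymxP/matrixP/(_ k j) UU; rewrite ann_cre; congr _%:M.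
by move: UU; rewrite !mxE => <-; apply: eq_bigr => i _; rewrite !mxE.
Qed.

End Car.

(** * Closure of the Fock space of a subspace under sums *)

Section InFock.
Context {R : realType} {d : nat} (V : 'M[R[i]]_d).
Implicit Types psi : ket R d.

Lemma in_fock0 : in_fock V 0.
Proof. by rewrite -(scale0r (vacuum : ket R d)); do !constructor. Qed.

Lemma in_fock_sum I (r : seq I) (P : pred I) (F : I -> ket R d) :
  (forall i, P i -> in_fock V (F i)) -> in_fock V (\sum_(i <- r | P i) F i).
Proof. by move=> h; elim/big_ind: _ => //; [exact: in_fock0 | exact: in_fock_add]. Qed.

End InFock.

(** * Commutation of even products, and additivity of degrees *)

Section Parity.
Context {C : numClosedFieldType} {n : nat}.
Implicit Types A B E D : 'M[C]_n.

(** Moving [E] past two factors that each anticommute with it produces two signs, which cancel. *)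
Lemma comm_mx_anticomm A B E :
  A *m E = - (E *m A) -> B *m E = - (E *m B) -> comm_mx (A *m B) E.
Proof.
by move=> AE BE; rewrite /comm_mx -mulmxA BE mulmxN !mulmxA AE mulNmx opprK.
Qed.

Lemma comm_mxMl A B E : comm_mx A E -> comm_mx B E -> comm_mx (A *m B) E.
Proof. by move=> /comm_mx_sym EA /comm_mx_sym EB; apply/comm_mx_sym/comm_mxM. Qed.

Lemma comm_mxDl A B E : comm_mx A E -> comm_mx B E -> comm_mx (A + B) E.
Proof. by move=> /comm_mx_sym EA /comm_mx_sym EB; apply/comm_mx_sym/comm_mxD. Qed.

Lemma comm_mxZl (a : C) A E : comm_mx A E -> comm_mx (a *: A) E.
Proof. by rewrite /comm_mx -scalemxAl -scalemxAr => ->. Qed.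

Lemma comm_mx_suml I (r : seq I) (P : pred I) (F : I -> 'M[C]_n) E :
  (forall i, P i -> comm_mx (F i) E) -> comm_mx (\sum_(i <- r | P i) F i) E.
Proof. by move=> h; apply/comm_mx_sym/comm_mx_sum => i /h /comm_mx_sym. Qed.

(** The commutator with [D] is a derivation, so the degrees [a] and [b] add up. With [D] the number
    operator, a product with as many creators as annihilators has degree 0 and conserves the
    particle number. *)
Lemma mulmx_shift D A B (a b : C) :
  D *m A = A *m D + a *: A -> D *m B = B *m D + b *: B ->
  D *m (A *m B) = A *m B *m D + (a + b) *: (A *m B).
Proof.
move=> DA DB; rewrite mulmxA DA mulmxDl -mulmxA DB mulmxDr mulmxA -addrA.
by rewrite -scalemxAl -scalemxAr -scalerDl [b + a]addrC.
Qed.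

End Parity.

(** * Number-conserving products *)

Section NumberComm.
Context {R : realType} {d : nat}.
Implicit Types u w : 'rV[R[i]]_d.

Lemma shift_cre u : number_op *m cre u = cre u *m number_op + 1 *: cre u.
Proof. by rewrite scale1r number_op_cre. Qed.

Lemma shift_ann u : number_op *m ann u = ann u *m number_op + (- 1) *: ann u.
Proof. by rewrite scaleN1r number_op_ann. Qed.

Lemma number_op_comm_cre_ann u w : comm_mx number_op (cre u *m ann w).
Proof.
rewrite /comm_mx (mulmx_shift (shift_cre u) (shift_ann w)).
by rewrite subrr scale0r addr0.
Qed.

Lemma number_op_comm_ann_cre u w : comm_mx number_op (ann u *m cre w).
Proof.
rewrite /comm_mx (mulmx_shift (shift_ann u) (shift_cre w)).
by rewrite addNr scale0r addr0.
Qed.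

Lemma number_op_comm_quartic (u1 u2 w1 w2 : 'rV[R[i]]_d) :
  comm_mx number_op (cre u1 *m cre u2 *m ann w2 *m ann w1).
Proof.
rewrite /comm_mx (mulmx_shift (mulmx_shift (mulmx_shift (shift_cre u1)
  (shift_cre u2)) (shift_ann w2)) (shift_ann w1)).
by rewrite addrK subrr scale0r addr0.
Qed.

End NumberComm.

(** * Environment modes and the projection onto the Fock space of [V] *)

Section Environment.
Context {R : realType} {r s : nat} (U : 'M[R[i]]_(r + s)).
Hypothesis Uunit : U \is unitarymx.
Local Notation d := (r + s)%N.
Local Notation b k := (ann (row k U)).
Local Notation bd k := (cre (row k U)).
Local Notation env j := (rshift r j).
Local Notation loc a := (lshift s a).

Lemma ann_cre_neq (j k : 'I_d) : j != k -> b j *m bd k = - (bd k *m b j).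
Proof.
move=> jk; apply/eqP; rewrite -addr_eq0 (ann_cre_unitary _ _ Uunit).
by rewrite [k == j]eq_sym (negPf jk) raddf0.
Qed.

Lemma cre_ann_neq (j k : 'I_d) : j != k -> bd j *m b k = - (b k *m bd j).
Proof. by move=> jk; rewrite (@ann_cre_neq k j) ?opprK // eq_sym. Qed.

Lemma ann_cre_eq (k : 'I_d) : b k *m bd k + bd k *m b k = 1%:M.
Proof. by rewrite (ann_cre_unitary _ _ Uunit) eqxx. Qed.


Lemma cre_sqr (u : 'rV[R[i]]_d) : cre u *m cre u = 0.
Proof.
have /eqP := cre_anticomm u u; rewrite -addr_eq0 -mulr2n -scaler_nat.
by rewrite scaler_eq0 pnatr_eq0 /= => /eqP.
Qed.

(** The projection onto the states in which environment mode [j] is empty. *)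
Definition hole (j : 'I_s) : fock_op R d := b (env j) *m bd (env j).

(** Plain commutation suits products of an even number of modes of [V]: each such mode anticommutes
    with the environment modes. The number operator of [V] and the Hamiltonian are sums of such
    products. *)
Definition local_op (A : fock_op R d) :=
  forall j : 'I_s, comm_mx A (b (env j)) /\ comm_mx A (bd (env j)).

Lemma local_opM A B : local_op A -> local_op B -> local_op (A *m B).
Proof. by move=> hA hB j; case: (hA j) (hB j) => ? ? [? ?]; split; apply: comm_mxMl. Qed.

Lemma local_opD A B : local_op A -> local_op B -> local_op (A + B).
Proof. by move=> hA hB j; case: (hA j) (hB j) => ? ? [? ?]; split; apply: comm_mxDl. Qed.

Lemma local_opZ a A : local_op A -> local_op (a *: A).
Proof. by move=> hA j; case: (hA j) => ? ?; split; apply: comm_mxZl. Qed.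

Lemma local_op_sum (I : finType) (F : I -> fock_op R d) :
  (forall i, local_op (F i)) -> local_op (\sum_i F i).
Proof.
by move=> h j; split; apply: comm_mx_suml => i _; case: (h i j).
Qed.

Lemma local_op1 : local_op 1%:M.
Proof. by move=> j; split; apply: comm1mx. Qed.

Lemma local_op_cre_ann (a c : 'I_r) : local_op (bd (loc a) *m b (loc c)).
Proof.
move=> j; split; apply: comm_mx_anticomm.
- by rewrite cre_ann_neq // eq_lrshift.
- exact: ann_anticomm.
- exact: cre_anticomm.
- by rewrite ann_cre_neq // eq_lrshift.
Qed.

Lemma local_op_quartic (a1 a2 c1 c2 : 'I_r) :
  local_op (bd (loc a1) *m bd (loc a2) *m b (loc c2) *m b (loc c1)).
Proof.
rewrite -mulmxA; apply: local_opM => j; split; apply: comm_mx_anticomm;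
  by [exact: ann_anticomm | exact: cre_anticomm
     | rewrite cre_ann_neq // eq_lrshift | rewrite ann_cre_neq // eq_lrshift].
Qed.

Lemma local_op_hole A j : local_op A -> comm_mx A (hole j).
Proof. by move=> /(_ j)[? ?]; apply: comm_mxM. Qed.

Lemma ann_hole (j : 'I_s) (k : 'I_d) : env j != k -> comm_mx (hole j) (b k).
Proof.
by move=> jk; apply: comm_mx_anticomm; [exact: ann_anticomm|exact: cre_ann_neq].
Qed.

Lemma cre_hole (j : 'I_s) (k : 'I_d) : env j != k -> comm_mx (hole j) (bd k).
Proof.
by move=> jk; apply: comm_mx_anticomm; [exact: ann_cre_neq|exact: cre_anticomm].
Qed.

Lemma comm_hole j k : comm_mx (hole j) (hole k).
Proof.
have [->|jk] := eqVneq j k; first exact: comm_mx_refl.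
by apply: comm_mxM; [apply: ann_hole|apply: cre_hole]; rewrite (inj_eq (@rshift_inj _ _)).
Qed.

Lemma holeJ j : (hole j)^t* = hole j.
Proof. by rewrite adjmxM annK. Qed.

(** With [l] all environment modes, the projection onto the Fock space of V. *)
Definition vac_proj (l : seq 'I_s) : fock_op R d :=
  foldr (fun j A => hole j *m A) 1%:M l.

Lemma comm_vac_proj l (A : fock_op R d) :
  {in l, forall j, comm_mx (hole j) A} -> comm_mx (vac_proj l) A.
Proof.
elim: l => [|j l IHl] h /=; first exact: comm1mx.
apply: comm_mxMl; first by apply: h; rewrite mem_head.
by apply: IHl => k kl; apply: h; rewrite inE kl orbT.
Qed.

Lemma vac_projJ l : (vac_proj l)^t* = vac_proj l.
Proof.
elim: l => [|j l IHl] /=; first exact: adjmx1.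
by rewrite adjmxM IHl holeJ; apply: comm_vac_proj => k _; apply: comm_hole.
Qed.

(** The creator commutes to the left past the holes of other modes until it meets the hole of its
    own mode, where its square appears and vanishes. *)
Lemma vac_proj_cre l j : j \in l -> vac_proj l *m bd (env j) = 0.
Proof.
elim: l => [//|k l IHl]; rewrite inE /= -mulmxA.
have [jl _|jl] := boolP (j \in l); first by rewrite IHl // mulmx0.
rewrite orbF => /eqP<- {k}.
have -> : vac_proj l *m bd (env j) = bd (env j) *m vac_proj l.
  apply: comm_vac_proj => k kl; apply: cre_hole; rewrite (inj_eq (@rshift_inj _ _)).
  by apply: contraNneq jl => <-.
by rewrite mulmxA /hole -[X in X *m _]mulmxA cre_sqr mulmx0 mul0mx.
Qed.

(** On a vector killed by [b (env j)], the relation [ann_cre_eq] reduces the hole of [j] to the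
    identity. *)
Lemma vac_proj_id l (psi : ket R d) :
  {in l, forall j, b (env j) *m psi = 0} -> vac_proj l *m psi = psi.
Proof.
elim: l => [|j l IHl] h /=; first by rewrite mul1mx.
rewrite -mulmxA IHl => [|k kl]; last by apply: h; rewrite inE kl orbT.
have /(congr1 (mulmx^~ psi)) := ann_cre_eq (env j).
by rewrite mulmxDl -[X in _ + X]mulmxA h ?mem_head // mulmx0 addr0 mul1mx.
Qed.

Local Notation Pi := (vac_proj (enum 'I_s)).

Lemma comm_vac_proj_cre (a : 'I_r) : comm_mx Pi (bd (loc a)).
Proof. by apply: comm_vac_proj => j _; apply: cre_hole; rewrite eq_rlshift. Qed.

Section Subspace.
Variable V : 'M[R[i]]_d.
Hypothesis UV : (usubmx U == V)%MS.

Lemma row_loc (a : 'I_r) : row (loc a) U = row a (usubmx U).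
Proof. by apply/rowP => i; rewrite !mxE. Qed.

Lemma row_loc_sub (a : 'I_r) : (row (loc a) U <= V)%MS.
Proof. by rewrite row_loc -(eqmxP UV) row_sub. Qed.

Lemma vac_proj_in_fock psi : in_fock V (Pi *m psi).
Proof.
rewrite [psi]ket_sum_basket mulmx_sumr; apply: in_fock_sum => i _.
rewrite -scalemxAr; apply: in_fock_scale.
move: (enum_val i : {set 'I_d}) => {i}S.
(* Induction on the number of particles, peeling off one creator of a reference mode at a time. *)
have [n] := ubnP #|S|; elim: n S => // n IHn S Sn.
have [->|[k kS]] := set_0Vmem S.
  rewrite vac_proj_id; first exact: in_fock_vac.
  by move=> j _; apply: ann_vacuum.
have -> : basket S = jwsign k S *: (cre (delta_mx 0 k) *m basket (S :\ k)) :> ket R d.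
  rewrite /cre ann_delta mode_cre_basket setD11 setD1K // scalerA.
  by rewrite jwsignD1 // ltnn mul1r jwsign_sqr scale1r.
rewrite -scalemxAr; apply: in_fock_scale.
(* The reference mode is expanded in the rows of [U]: the projection kills the environment
   components, and commutes with the creators of the components in [V]. *)
have -> : delta_mx 0 k = delta_mx 0 k *m U^t* *m U :> 'rV_d.
  by rewrite -mulmxA; move/unitarymxP/mulmx1C: Uunit => ->; rewrite mulmx1.
rewrite cre_mulmx mulmx_suml mulmx_sumr; apply: in_fock_sum => j _.
rewrite -scalemxAl -scalemxAr; apply: in_fock_scale; rewrite mulmxA.
case: (split_ordP j) => a ->; last first.
  by rewrite vac_proj_cre ?mem_enum // mul0mx; apply: in_fock0.
rewrite comm_vac_proj_cre -mulmxA; apply: in_fock_cre; first exact: row_loc_sub.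
by apply: IHn; rewrite (cardsD1 k) kS in Sn.
Qed.

(** Induction on the generation of the Fock space: the vacuum is fixed, and creators of modes of
    [V], expanded in the first rows of [U], commute with the projection. *)
Lemma vac_proj_fixed psi : in_fock V psi -> Pi *m psi = psi.
Proof.
elim=> {psi} [|u psi uV _ IH|psi phi _ IHpsi _ IHphi|z psi _ IH].
- by apply: vac_proj_id => j _; apply: ann_vacuum.
- move: uV; rewrite -(eqmxP UV) => /submxP[w ->]; rewrite cre_mulmx.
  rewrite mulmx_suml mulmx_sumr; apply: eq_bigr => a _.
  rewrite -scalemxAl -scalemxAr -row_loc mulmxA comm_vac_proj_cre -mulmxA.
  by rewrite IH.
- by rewrite mulmxDr IHpsi IHphi.
- by rewrite -scalemxAr IH.
Qed.

Lemma killed_in_fock psi : (forall j : 'I_s, b (env j) *m psi = 0) -> in_fock V psi.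
Proof.
by move=> h; rewrite -[psi](@vac_proj_id (enum 'I_s)) //; apply: vac_proj_in_fock.
Qed.

End Subspace.
End Environment.

(** * Expectation values, norms and ensembles of unnormalised vectors *)

Section Expect.
Context {R : realType} {d : nat}.
Implicit Types (A B : fock_op R d) (psi : ket R d).

Lemma expectD A B psi : expect (A + B) psi = expect A psi + expect B psi.
Proof. by rewrite /expect mulmxDr mulmxDl mxE. Qed.

Lemma expectZ a A psi : expect (a *: A) psi = a * expect A psi.
Proof. by rewrite /expect -scalemxAr -scalemxAl mxE. Qed.

Lemma expect_sum (I : finType) (F : I -> fock_op R d) psi :
  expect (\sum_i F i) psi = \sum_i expect (F i) psi.
Proof. by rewrite /expect mulmx_sumr mulmx_suml summxE. Qed.

Lemma expect_scale A a psi : expect A (a *: psi) = (a^* * a) * expect A psi.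
Proof.
by rewrite /expect adjmxZ -!scalemxAl -scalemxAr !mxE mulrA.
Qed.

Lemma expect_mulmx A B psi : expect A (B *m psi) = expect (B^t* *m A *m B) psi.
Proof. by rewrite /expect adjmxM !mulmxA. Qed.

Lemma expect_eq A a psi :
  A *m psi = a *: psi -> expect A psi = a * expect 1%:M psi.
Proof. by move=> Ap; rewrite /expect mulmx1 -mulmxA Ap -scalemxAr mxE. Qed.

Lemma expect_normalized psi : normalized psi -> expect 1%:M psi = 1.
Proof. by rewrite /expect mulmx1 => ->; rewrite mxE. Qed.

Definition sqnorm psi : R := complex.Re (expect 1%:M psi).

Lemma expect1E psi : expect 1%:M psi = \sum_i `|psi i 0| ^+ 2.
Proof.
rewrite /expect mulmx1 mxE; apply: eq_bigr => i _.
by rewrite !mxE normCK mulrC.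
Qed.

Lemma expect1_ge0 psi : 0 <= expect 1%:M psi.
Proof. by rewrite expect1E sumr_ge0 // => i _; rewrite exprn_ge0. Qed.

Lemma sqnormE psi : expect 1%:M psi = (sqnorm psi)%:C.
Proof. by rewrite /sqnorm RRe_real // ger0_real // expect1_ge0. Qed.

Lemma sqnorm_ge0 psi : 0 <= sqnorm psi.
Proof. by rewrite -ler0c -sqnormE expect1_ge0. Qed.

Lemma sqnorm_eq0 psi : sqnorm psi = 0 -> psi = 0.
Proof.
move=> p0; have := sqnormE psi; rewrite p0 expect1E => /eqP.
rewrite psumr_eq0 => [|i _]; last by rewrite exprn_ge0.
move=> /allP h; apply/colP => i; rewrite mxE.
have := h i (mem_index_enum _); rewrite sqrf_eq0 normr_eq0.
by move/eqP.
Qed.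

Lemma normalized_vacuum : normalized (vacuum : ket R d).
Proof.
rewrite /normalized /vacuum trmx_delta map_delta_mx mul_delta_mx.
by apply/matrixP => i j; rewrite !ord1 !mxE.
Qed.

Lemma n_particle_vacuum : n_particle 0 (vacuum : ket R d).
Proof.
move=> i iS; rewrite mxE -(inj_eq enum_val_inj) enum_rankK.
by move: iS; case: (_ =P set0) => // ->; rewrite cards0.
Qed.

(** Unnormalised vectors: the squared norms are the weights, and a null vector is
    replaced by the vacuum with weight 0. *)
Lemma ensemble_of_seq (V : 'M[R[i]]_d) (H : fock_op R d) (Nbar e : R)
    (L : seq (nat * ket R d)) :
  {in L, forall q, in_fock V q.2 /\ n_particle q.1 q.2} ->
  \sum_(q <- L) expect 1%:M q.2 = 1 ->
  \sum_(q <- L) q.1%:R * expect 1%:M q.2 = Nbar%:C ->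
  \sum_(q <- L) expect H q.2 = e%:C ->
  ensemble_energy V H Nbar e.
Proof.
move=> hL h1 hN he.
pose nm (q : nat * ket R d) : nat * ket R d := if sqnorm q.2 == 0 then (0%N, vacuum) else
  (q.1, (Num.sqrt (sqnorm q.2))^-1%:C *: q.2).
have nmE q A : (sqnorm q.2)%:C * expect A (nm q).2 = expect A q.2.
  rewrite /nm; have [z|nz] := eqVneq (sqnorm q.2) 0.
    by rewrite z mul0r (sqnorm_eq0 z) /expect mulmx0 mxE.
  rewrite /= expect_scale mulrA.
  rewrite [X in _ * (X * _)](_ : _ = (Num.sqrt (sqnorm q.2))^-1%:C); last exact: conjc_real.
  rewrite -!rmorphM /= -invfM -expr2 sqr_sqrtr ?sqnorm_ge0 //.
  by rewrite mulfV // mul1r.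
have nm1 q : expect 1%:M (nm q).2 = 1.
  have [z|nz] := eqVneq (sqnorm q.2) 0.
    by rewrite /nm z eqxx; apply: expect_normalized normalized_vacuum.
  have nzC : (sqnorm q.2)%:C != 0 by apply: contra nz => /eqP[->].
  by apply: (mulfI nzC); rewrite nmE mulr1 sqnormE.
exists (size L), (fun i => (nm (tnth (in_tuple L) i)).1),
  (fun i => sqnorm (tnth (in_tuple L) i).2),
  (fun i => (nm (tnth (in_tuple L) i)).2); split.
- split=> [i|]; first exact: sqnorm_ge0.
  rewrite -(big_tnth _ _ L xpredT (fun q => sqnorm q.2)).
  apply: complexI; rewrite rmorph_sum rmorph1 -h1.
  by apply: eq_bigr => q _; rewrite sqnormE.
- move=> i; set q := tnth _ _; have [fq nq] := hL q (mem_tnth _ _).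
  split.
  + by rewrite /nm; case: ifP => _ /=; [exact: in_fock_vac | exact: in_fock_scale].
  + apply/matrixP => a c; rewrite !ord1; have := nm1 q.
    by rewrite /expect mulmx1 => ->; rewrite mxE.
  + rewrite /nm; case: ifP => _ /=; first exact: n_particle_vacuum.
    exact: n_particleZ.
- rewrite -(big_tnth _ _ L xpredT (fun q => sqnorm q.2 * (nm q).1%:R)).
  apply: complexI; rewrite -hN rmorph_sum.
  apply: eq_bigr => q _; rewrite rmorphM rmorph_nat mulrC sqnormE /nm.
  by have [->|] := eqVneq (sqnorm q.2) 0; rewrite ?rmorph0 ?mulr0.
- rewrite -(big_tnth _ _ L xpredT (fun q => (sqnorm q.2)%:C * expect H (nm q).2)).
  by rewrite -he; apply: eq_bigr => q _; rewrite nmE.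
Qed.

End Expect.

(** * Splitting states along the environment modes *)

Section Split.
Context {R : realType} {r s : nat} (U : 'M[R[i]]_(r + s)).
Hypothesis Uunit : U \is unitarymx.
Local Notation d := (r + s)%N.
Local Notation b k := (ann (row k U)).
Local Notation bd k := (cre (row k U)).
Local Notation env j := (rshift r j).

Lemma ann_sqr (u : 'rV[R[i]]_d) : ann u *m ann u = 0.
Proof. by rewrite -annK -adjmxM cre_sqr trmx0 map_mx0. Qed.

Lemma hole_idem j : hole U j *m hole U j = hole U j.
Proof.
rewrite /hole mulmxA -[_ *m b _]mulmxA.
have /eqP := ann_cre_eq Uunit (env j); rewrite addrC eq_sym -subr_eq => /eqP <-.
by rewrite mulmxBr mulmx1 mulmxBl -!mulmxA cre_sqr !mulmx0 subr0.
Qed.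

(** Since [A] commutes with the creator and with the hole, which is idempotent, the right side is
    the expectation of [A] times the anticommutator of the mode with its creator, which is 1. *)
Lemma expect_split j A (psi : ket R d) : local_op U A ->
  expect A psi = expect A (b (env j) *m psi) + expect A (hole U j *m psi).
Proof.
move=> hA; rewrite !expect_mulmx -expectD; congr (expect _ psi).
rewrite holeJ -/(bd (env j)) -[hole U j *m A](local_op_hole j hA).
have [_ <-] := hA j; rewrite -mulmxA -[X in _ + X]mulmxA -mulmxDr hole_idem.
by rewrite addrC (ann_cre_eq Uunit) mulmx1.
Qed.

(** Induction on the modes. Splitting along a new mode [k] preserves what was achieved for a mode
    [j] different from [k], since [b (env j)] anticommutes with [b (env k)] and commutes with the
    hole of [k]. *)
Lemma env_split (l : seq 'I_s) (L : seq (nat * ket R d)) :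
  {in L, forall q, n_particle q.1 q.2} ->
  exists L' : seq (nat * ket R d),
  [/\ {in L', forall q, n_particle q.1 q.2},
      {in L', forall q, {in l, forall j, b (env j) *m q.2 = 0}} &
      forall A, local_op U A ->
        \sum_(q <- L') expect A q.2 = \sum_(q <- L) expect A q.2].
Proof.
move=> hL; elim: l => [|k l [L' [nL' kL' sL']]]; first by exists L.
(* The branch with [k] occupied loses its particle; the branch with [k] empty keeps its particle
   number. *)
exists (flatten [seq [:: (q.1.-1, b (env k) *m q.2); (q.1, hole U k *m q.2)] | q <- L']).
split.
- move=> p /flatten_mapP[q qL']; rewrite !inE => /orP[]/eqP-> /=.
    exact/n_particle_ann/nL'.
  apply/n_particleP; have /n_particleP np := nL' q qL'.
  by rewrite mulmxA number_op_comm_ann_cre -mulmxA np scalemxAr.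
- move=> p /flatten_mapP[q qL'] qE j jkl.
  have [->|jk] := eqVneq j k.
    move: qE; rewrite !inE => /orP[]/eqP-> /=; rewrite /hole !mulmxA ann_sqr.
      by rewrite mul0mx.
    by rewrite !mul0mx.
  have jl : j \in l by move: jkl; rewrite inE (negPf jk).
  have q0 := kL' q qL' j jl.
  move: qE; rewrite !inE => /orP[]/eqP-> /=; rewrite mulmxA.
    by rewrite ann_anticomm mulNmx -mulmxA q0 mulmx0 oppr0.
  rewrite -(@ann_hole _ _ _ _ Uunit) ?(inj_eq (@rshift_inj _ _)) 1?eq_sym //.
  by rewrite -mulmxA q0 mulmx0.
- move=> A hA; rewrite big_flatten big_map /= -sL' //; apply: eq_bigr => q _.
  by rewrite big_cons big_seq1 -expect_split.
Qed.

End Split.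

(** * Simultaneous diagonalisation of commuting Hermitian matrices *)

Section JointEigenbasis.
Context {C : numClosedFieldType} {n : nat}.

(** A unitary [P] triangularises the whole commuting family at once, and a triangular Hermitian
    matrix is diagonal; the columns of the adjoint of [P] are the eigenvectors. *)
Lemma joint_eigenbasis (As : seq 'M[C]_n) :
  {in As &, forall A B, comm_mx A B} ->
  {in As, forall A : 'M[C]_n, A^t* = A} ->
  exists phi : 'I_n -> 'cV[C]_n,
  [/\ forall j, (phi j)^t* *m phi j = 1%:M,
      \sum_j phi j *m (phi j)^t* = 1%:M &
      {in As, forall A : 'M[C]_n, forall j, exists a, A *m phi j = a *: phi j}].
Proof.
move=> cAs hAs; have [P Pu /allP PAs] := cotrigonalization cAs.
have PP := unitarymxP Pu; have PtP := mulmx1C PP.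
pose phi j := col j (P^t*); exists phi.
have phiJ j : (phi j)^t* = row j P.
  by apply/rowP => i; rewrite !mxE conjCK.
have phiE j : P *m phi j = delta_mx j 0.
  by rewrite /phi colE mulmxA PP mul1mx.
split=> [j||A AAs j].
- rewrite phiJ; apply/matrixP => x y; rewrite !ord1 -row_mul phiE.
  by rewrite !mxE !eqxx.
- under eq_bigr => j _ do rewrite phiJ.
  rewrite -PtP; apply/matrixP => x y; rewrite summxE [RHS]mxE; apply: eq_bigr => j _.
  by rewrite mxE big_ord1 !mxE.
- have := PAs A AAs; rewrite /similar_to /= conjymx // => /is_trig_mxP Tt.
  set T := P *m A *m P^t* in Tt.
  have TJ : T^t* = T by rewrite /T !adjmxM trmxCK hAs // mulmxA.
  have AE : A = P^t* *m T *m P by rewrite /T !mulmxA PtP mul1mx -mulmxA PtP mulmx1.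
  clearbody T.
  have Td x : x != j -> T x j = 0.
    rewrite neq_ltn => /orP[xj|jx]; first exact: Tt.
    by rewrite -TJ !mxE Tt ?conjC0.
  exists (T j j).
  rewrite AE -mulmxA phiE -mulmxA -colE.
  have -> : col j T = T j j *: delta_mx j 0.
    apply/colP => x; rewrite !mxE eqxx andbT.
    by have [->|/Td->] := eqVneq x j; rewrite ?mulr1 ?mulr0.
  by rewrite -scalemxAr -colE.
Qed.


End JointEigenbasis.

(** * A linear program with two equality constraints *)

Section Weights.
Context {F : realFieldType} {J : finType} (P : pred J) (m eps : J -> F) (c : F).

Definition feasible (w : J -> F) :=
  [/\ forall j, 0 <= w j, \sum_(j | P j) w j = 1 & \sum_(j | P j) w j * m j = c].

Let sum_delta j (f : J -> F) : P j -> \sum_(x | P x) (x == j)%:R * f x = f j.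
Proof.
move=> Pj; rewrite (bigD1 j) //= eqxx mul1r big1 ?addr0 // => k /andP[_ /negPf->].
by rewrite mul0r.
Qed.

(** The candidates are two-point weights whose means of [m] straddle [c]. There are finitely many
    pairs, so a best one exists, and the inequalities between pairs average to optimality against
    every feasible [w]. *)
Lemma feasible_min : (exists w, feasible w) ->
  exists2 w0, feasible w0 &
    forall w, feasible w -> \sum_(j | P j) w0 j * eps j <= \sum_(j | P j) w j * eps j.
Proof.
case=> w1 fw1.
have sum0 w : feasible w -> \sum_(j | P j) w j * (m j - c) = 0.
  case=> _ w1' wc; under eq_bigr do rewrite mulrBr.
  by rewrite sumrB wc -mulr_suml w1' mul1r subrr.
pose Q (p : J * J) := [&& P p.1, P p.2, m p.1 <= c & c <= m p.2].
(* If [m] were on one side of [c] strictly throughout [P], the vanishing sum of [w1 j * (m j - c)]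
   would force all weights to be zero, against their sum being 1. *)
have [p0 Qp0] : exists p, Q p.
  have [w0 w1' wc] := fw1; have s0 := sum0 _ fw1.
  have [j Pj jc] : exists2 j, P j & m j <= c.
    apply/exists_inP; apply: contraT; rewrite negb_exists_in => /forall_inP h.
    have gt j : P j -> 0 < m j - c by move=> /h; rewrite subr_gt0 ltNge.
    move/eqP: s0; rewrite psumr_eq0 => [|j /gt/ltW ?]; last exact: mulr_ge0.
    move/allP => z; have : \sum_(j | P j) w1 j = 0.
      apply: big1 => j Pj; have := z j (mem_index_enum _).
      by rewrite Pj mulf_eq0 (gt_eqF (gt j Pj)) orbF => /eqP.
    by rewrite w1' => /eqP; rewrite oner_eq0.
  have [k Pk kc] : exists2 k, P k & c <= m k.
    apply/exists_inP; apply: contraT; rewrite negb_exists_in => /forall_inP h.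
    have gt k : P k -> 0 < c - m k by move=> /h; rewrite subr_gt0 ltNge.
    have {}s0 : \sum_(j | P j) w1 j * (c - m j) = 0.
      by rewrite -[RHS]oppr0 -[in RHS]s0 -sumrN; apply: eq_bigr => k _; rewrite -mulrN opprB.
    move/eqP: s0; rewrite psumr_eq0 => [|k /gt/ltW ?]; last exact: mulr_ge0.
    move/allP => z; have : \sum_(j | P j) w1 j = 0.
      apply: big1 => k Pk; have := z k (mem_index_enum _).
      by rewrite Pk mulf_eq0 (gt_eqF (gt k Pk)) orbF => /eqP.
    by rewrite w1' => /eqP; rewrite oner_eq0.
  by exists (j, k); rewrite /Q /= Pj Pk jc.
(* Junk value [x / 0 = 0]: when [m p.1 = c = m p.2] all weight goes to [p.2] *)
pose a (p : J * J) := (m p.2 - c) / (m p.2 - m p.1).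
pose g p := a p * eps p.1 + (1 - a p) * eps p.2.
case: (arg_minP g Qp0) => -[j k] /and4P[/= Pj Pk jc kc] gmin.
set E := g (j, k) in gmin.
pose w0 x := a (j, k) * (x == j)%:R + (1 - a (j, k)) * (x == k)%:R.
have w0E (f : J -> F) : \sum_(x | P x) w0 x * f x = a (j, k) * f j + (1 - a (j, k)) * f k.
  under eq_bigr do rewrite mulrDl -[a _ * _ * _]mulrA -[(1 - _) * _ * _]mulrA.
  by rewrite big_split /= -!mulr_sumr !sum_delta.
have a01 : 0 <= a (j, k) <= 1.
  rewrite /a /= divr_ge0 ?subr_ge0 ?(le_trans jc) //=.
  have [e|ne] := eqVneq (m k) (m j); first by rewrite e subrr invr0 mulr0.
  rewrite ler_pdivrMr ?mul1r ?lerD2l ?lerN2 //.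
  by rewrite subr_gt0 lt_neqAle eq_sym ne (le_trans jc).
case/andP: a01 => a0 a1; exists w0.
  split=> [x||].
  - by rewrite /w0 addr_ge0 // mulr_ge0 ?ler0n // subr_ge0.
  - have := w0E (fun=> 1); rewrite !mulr1 addrC subrK => <-.
    by apply: eq_bigr => x _; rewrite mulr1.
  - rewrite w0E /a /=; have [e|ne] := eqVneq (m k) (m j).
      rewrite e subrr invr0 mulr0 mul0r add0r subr0 mul1r.
      by apply/eqP; rewrite eq_le jc -e kc.
    by field; rewrite subr_eq0.
move=> w fw; have [wge w1' _] := fw; rewrite w0E -/(g (j, k)) -/E.
pose f x := eps x - E; pose mu x := m x - c.
have -> : \sum_(x | P x) w x * eps x = \sum_(x | P x) w x * f x + E.
  rewrite -[E in RHS]mul1r -w1' mulr_suml -big_split /=.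
  by apply: eq_bigr => x _; rewrite -mulrDr subrK.
rewrite lerDr.
(* This is minimality of [E] at the pair [(x, y)], cleared of the denominator [m y - m x]. *)
have pair x y : P x -> P y -> mu x <= 0 -> 0 < mu y -> 0 <= mu y * f x - mu x * f y.
  move=> Px Py x0 y0.
  have xy : 0 < m y - m x by rewrite /mu in x0 y0; lra.
  have := gmin (x, y); rewrite /Q /= Px Py -subr_le0 x0 -subr_ge0 ltW // => /(_ isT).
  rewrite -subr_ge0 -(pmulr_rge0 _ xy) /g /a /= => /le_trans; apply.
  by rewrite le_eqVlt; apply/orP; left; apply/eqP; rewrite /mu /f; field; rewrite gt_eqF.
(* The degenerate pair [(x, x)] is admissible, and there [a] is 0 / 0 = 0, so that [g (x, x)] is
   [eps x]. *)
have f0 x : P x -> mu x = 0 -> 0 <= f x.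
  move=> Px /eqP; rewrite subr_eq0 => /eqP xc.
  have := gmin (x, x); rewrite /Q /= Px xc lexx => /(_ isT).
  by rewrite /g /a /= xc subrr mul0r mul0r add0r subr0 mul1r subr_ge0.
(* The mean constraint makes the positive and negative parts of the sum of [w x * mu x] cancel, so
   [M] is the size of both. *)
pose M := \sum_(x | P x && ~~ (mu x <= 0)) w x * mu x.
have M0 : 0 <= M.
  by apply: sumr_ge0 => x /andP[_]; rewrite -ltNge => /ltW ?; apply: mulr_ge0.
have MN : \sum_(x | P x && (mu x <= 0)) w x * mu x = - M.
  apply/eqP; rewrite -addr_eq0; have := sum0 _ fw.
  by rewrite (bigID (fun x => mu x <= 0)) /= => /eqP.
have [Mp|] := ltP 0 M.
  rewrite -(pmulr_rge0 _ Mp) (bigID (fun x => mu x <= 0)) /= mulrDr.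
  (* Writing [M] as the positive part in the first term and as minus the negative part in the second
     turns the sum into a nonnegative combination of the pair inequalities. *)
  have -> : M * (\sum_(x | P x && (mu x <= 0)) w x * f x) +
            M * (\sum_(x | P x && ~~ (mu x <= 0)) w x * f x) =
    \sum_(x | P x && (mu x <= 0)) \sum_(y | P y && ~~ (mu y <= 0))
       w x * w y * (mu y * f x - mu x * f y).
    rewrite -[X in _ + X * _]opprK -MN mulNr /M [X in X + _]mulrC !mulr_suml -sumrB.
    apply: eq_bigr => x _; rewrite !mulr_sumr -sumrB; apply: eq_bigr => y _; ring.
  apply: sumr_ge0 => x /andP[Px x0]; apply: sumr_ge0 => y /andP[Py].
  by rewrite -ltNge => y0; rewrite mulr_ge0 ?pair // mulr_ge0.
(* Both parts now vanish term by term, so all the weight sits at points with [mu x = 0], where [f0]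
   applies. *)
move=> Mle; have Mz : M = 0 by apply/eqP; rewrite eq_le Mle.
apply: sumr_ge0 => x Px; suff [->|/(f0 _ Px) fx] : w x = 0 \/ mu x = 0.
- by rewrite mul0r.
- exact: mulr_ge0.
suff : w x * mu x = 0 by move=> /eqP; rewrite mulf_eq0 => /orP[]/eqP; [left|right].
have [x0|x0] := boolP (mu x <= 0).
  have /eqP : \sum_(x | P x && (mu x <= 0)) w x * - mu x = 0.
    by under eq_bigr do rewrite mulrN; rewrite sumrN MN opprK.
  rewrite psumr_eq0 => [|y /andP[_ y0]]; last by rewrite mulr_ge0 // oppr_ge0.
  move/allP/(_ x (mem_index_enum _)); rewrite Px x0 mulrN oppr_eq0.
  by move/eqP.
move/eqP: Mz; rewrite psumr_eq0 => [|y /andP[_]]; last first.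
  by rewrite -ltNge => /ltW ?; apply: mulr_ge0.
by move/allP/(_ x (mem_index_enum _)); rewrite Px x0 => /eqP.
Qed.


End Weights.

(** Used for hermiticity of the two-body term, whose adjoint exchanges the creator pair with the
    annihilator pair. *)
Lemma sum4_swap (M : nmodType) (I : finType) (F : I -> I -> I -> I -> M) :
  \sum_a \sum_b \sum_c \sum_e F a b c e = \sum_a \sum_b \sum_c \sum_e F c e a b.
Proof.
have pairs G : \sum_a \sum_b \sum_c \sum_e G a b c e =
    \sum_(p : I * I) \sum_(q : I * I) G p.1 p.2 q.1 q.2 :> M.
  rewrite pair_bigA; apply: eq_bigr => p _.
  by rewrite pair_bigA.
by rewrite !pairs exchange_big.
Qed.

(** * Existence of the ground-state energy *)

Section GroundState.
Context {R : realType} {r s : nat} (U V : 'M[R[i]]_(r + s)).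
Hypotheses (Uunit : U \is unitarymx) (UV : (usubmx U == V)%MS).
Local Notation d := (r + s)%N.
Local Notation b k := (ann (row k U)).
Local Notation bd k := (cre (row k U)).
Local Notation env j := (rshift r j).
Local Notation loc a := (lshift s a).
Local Notation Pi := (vac_proj U (enum 'I_s)).

Lemma expect_herm (A : fock_op R d) psi : A^t* = A ->
  expect A psi = (complex.Re (expect A psi))%:C.
Proof.
move=> AJ; rewrite RRe_real //; apply/CrealP.
have <- : (psi^t* *m A *m psi)^t* 0 0 = (expect A psi)^*.
  by rewrite [LHS]mxE [in LHS]mxE.
by rewrite !adjmxM trmxCK AJ mulmxA.
Qed.

Section Hamiltonian.
Variable H : fock_op R d.
Hypotheses (HJ : H^t* = H) (Hloc : local_op U H) (HD : comm_mx number_op H).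

(** [Pi] is a product of holes; each commutes with [H] by locality, and with the number operator
    because it has one creator and one annihilator. *)
Lemma commuting_family : {in [:: H; number_op; Pi] &, forall A B, comm_mx A B}.
Proof.
have HP : comm_mx Pi H.
  by apply: comm_vac_proj => j _; apply/comm_mx_sym/local_op_hole.
have DP : comm_mx Pi number_op.
  by apply: comm_vac_proj => j _; apply/comm_mx_sym/number_op_comm_ann_cre.
move=> A B; rewrite !inE => /or3P[] /eqP-> /or3P[] /eqP->;
  by [exact: comm_mx_refl | | apply: comm_mx_sym].
Qed.

Lemma joint_eigenbasis_fock :
  exists (phi : 'I_#|{set 'I_d}| -> ket R d) (eps : 'I_#|{set 'I_d}| -> R)
    (nu : 'I_#|{set 'I_d}| -> nat) (pr : 'I_#|{set 'I_d}| -> R[i]),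
  [/\ forall j, normalized (phi j), \sum_j phi j *m (phi j)^t* = 1%:M,
      forall j, H *m phi j = (eps j)%:C *: phi j,
      forall j, n_particle (nu j) (phi j) &
      forall j, Pi *m phi j = pr j *: phi j].
Proof.
have hJ : {in [:: H; number_op; Pi], forall A : fock_op R d, A^t* = A}.
  by move=> A; rewrite !inE => /or3P[] /eqP-> //; [exact: number_opJ|exact: vac_projJ].
have [phi [nphi sphi eig]] := joint_eigenbasis commuting_family hJ.
have [eps Heps] : exists eps, forall j, H *m phi j = (eps j)%:C *: phi j.
  exists (fun j => complex.Re (expect H (phi j))) => j; rewrite -expect_herm //.
  have [a Ha] := eig H (mem_head _ _) j.
  by rewrite (expect_eq Ha) expect_normalized // mulr1.
have [nu hnu] : exists nu : 'I_#|{set 'I_d}| -> nat, forall j, n_particle (nu j) (phi j).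
  apply: (@fin_all_exists _ _ (fun j (n : nat) => n_particle n (phi j))) => j.
  have [a Da] : exists a, number_op *m phi j = a *: phi j.
    by apply: eig; rewrite !inE eqxx orbT.
  have [i phi0] : exists i, phi j i 0 != 0.
    apply/existsP; apply: contraT; rewrite negb_exists => /forallP p0.
    have := expect_normalized (nphi j); rewrite (_ : phi j = 0).
      by rewrite /expect mulmx0 mxE => /esym/eqP; rewrite oner_eq0.
    by apply/colP => i; rewrite mxE; apply/eqP; have := p0 i; rewrite negbK.
  (* The number operator is diagonal in the occupation basis, so its eigenvalue can be read off at
     any nonzero coordinate of [phi j]. *)
  exists #|(enum_val i : {set 'I_d})|; apply/n_particleP; rewrite Da.
  move/matrixP/(_ i 0): Da; rewrite number_opE mxE.
  by move/(mulIf phi0) => ->.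
have [pr hpr] : exists pr, forall j, Pi *m phi j = pr j *: phi j.
  apply: (@fin_all_exists _ _ (fun j a => Pi *m phi j = a *: phi j)) => j.
  by apply: eig; rewrite !inE eqxx !orbT.
by exists phi, eps, nu, pr.
Qed.

Lemma ground_energy_exists Nbar e :
  ensemble_energy V H Nbar e -> exists E0, ground_energy V H Nbar E0.
Proof.
move=> ee; have [phi [eps [nu [pr [nphi sphi Heps hnu hpr]]]]] := joint_eigenbasis_fock.
pose c j (psi : ket R d) := ((phi j)^t* *m psi) 0 0.
(* The probability of finding [psi] in the eigenstate [phi j]. *)
pose q j psi : R := complex.Re (`|c j psi| ^+ 2).
have qE j psi : (q j psi)%:C = `|c j psi| ^+ 2.
  by rewrite RRe_real // ger0_real // exprn_ge0.
have q_ge0 j psi : 0 <= q j psi by rewrite -ler0c qE exprn_ge0.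
have expect_eig (A : fock_op R d) (a : _ -> R) psi : (forall j, A *m phi j = (a j)%:C *: phi j) ->
    expect A psi = (\sum_j q j psi * a j)%:C.
  move=> Aphi; rewrite /expect -[psi in _ *m psi]mul1mx -sphi mulmx_suml mulmx_sumr summxE.
  rewrite rmorph_sum; apply: eq_bigr => j _.
  have -> : psi^t* *m A *m (phi j *m (phi j)^t* *m psi) =
      psi^t* *m (A *m phi j) *m ((phi j)^t* *m psi) by rewrite !mulmxA.
  rewrite Aphi -scalemxAr -scalemxAl mxE [X in _ * X]mxE big_ord1 rmorphM /= qE normCK.
  rewrite mulrC; congr (_ * _); rewrite mulrC; congr (_ * _).
  have -> : psi^t* *m phi j = ((phi j)^t* *m psi)^t* by rewrite adjmxM trmxCK.
  by rewrite [LHS]mxE [in LHS]mxE.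
(* Selects the eigenvectors in the Fock space of [V]: with a nonzero eigenvalue, [phi j] lies in the
   image of [Pi]; with eigenvalue 0, it is orthogonal to every vector fixed by [Pi]. *)
pose P j := pr j != 0.
have phi_fock j : P j -> in_fock V (phi j).
  move=> Pj; have -> : phi j = (pr j)^-1 *: (Pi *m phi j).
    by rewrite hpr scalerA mulVf // scale1r.
  exact/in_fock_scale/vac_proj_in_fock.
have q0 j psi : in_fock V psi -> ~~ P j -> q j psi = 0.
  move=> /(vac_proj_fixed Uunit UV) <- /negPn/eqP p0; apply: complexI; rewrite qE /c.
  rewrite mulmxA -(vac_projJ Uunit (enum 'I_s)) -adjmxM hpr p0 scale0r.
  by rewrite trmx0 map_mx0 mul0mx mxE normr0 expr0n.
pose nuR j : R := (nu j)%:R.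
have Done j : 1%:M *m phi j = (1 : R)%:C *: phi j by rewrite mul1mx scale1r.
have Dnu j : number_op *m phi j = (nuR j)%:C *: phi j.
  by have /n_particleP -> := hnu j; rewrite rmorph_nat.
(* An ensemble induces its mean probabilities on the eigenbasis; they reproduce its norm, particle
   number and energy, as all three operators are diagonal there. *)
have to_weights f : ensemble_energy V H Nbar f ->
    exists2 w, feasible P nuR Nbar w & \sum_(j | P j) w j * eps j = f.
  case=> k [n [x [psi [[x0 x1] hpsi xn xf]]]].
  pose w j := \sum_i x i * q j (psi i).
  have wE (A : fock_op R d) a : (forall j, A *m phi j = (a j)%:C *: phi j) ->
      (\sum_(j | P j) w j * a j)%:C = \sum_i (x i)%:C * expect A (psi i).
    move=> Aphi; have -> : \sum_(j | P j) w j * a j = \sum_j w j * a j.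
      rewrite [RHS](bigID P) /= [X in _ + X]big1 ?addr0 // => j Pj.
      by rewrite /w big1 ?mul0r // => i _; rewrite q0 ?mulr0 //; case: (hpsi i).
    under [in RHS]eq_bigr => i _ do rewrite (expect_eig _ _ _ Aphi) -rmorphM /= mulr_sumr.
    rewrite -rmorph_sum exchange_big /=; congr _%:C; apply: eq_bigr => j _.
    by rewrite mulr_suml; apply: eq_bigr => i _; rewrite mulrA.
  exists w; last by apply: complexI; rewrite (wE H).
  split=> [j||].
  - by apply: sumr_ge0 => i _; rewrite mulr_ge0.
  - apply: complexI; under eq_bigr do rewrite -[w _]mulr1.
    rewrite (wE 1%:M) // -x1 rmorph_sum; apply: eq_bigr => i _.
    by rewrite expect_normalized ?mulr1 //; case: (hpsi i).
  - apply: complexI; rewrite (wE number_op) // -xn rmorph_sum; apply: eq_bigr => i _.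
    have [_ no /n_particleP np] := hpsi i.
    by rewrite (expect_eq np) expect_normalized // mulr1 rmorphM rmorph_nat.
(* Conversely, feasible weights define the mixture of the selected eigenvectors, each scaled by the
   square root of its weight. *)
have of_weights w : feasible P nuR Nbar w ->
    ensemble_energy V H Nbar (\sum_(j | P j) w j * eps j).
  case=> w0 w1 wn.
  have wE (A : fock_op R d) a j : A *m phi j = (a j)%:C *: phi j ->
      expect A ((Num.sqrt (w j))%:C *: phi j) = (w j * a j)%:C.
    move=> Aphi; rewrite expect_scale (expect_eq Aphi) expect_normalized // mulr1.
    rewrite [X in X * _ * _](_ : _ = (Num.sqrt (w j))%:C); last exact: conjc_real.
    by rewrite -!rmorphM /= -expr2 sqr_sqrtr.
  apply: (@ensemble_of_seq _ _ _ _ _ _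
    [seq (nu j, (Num.sqrt (w j))%:C *: phi j) | j <- index_enum _ & P j]).
  - move=> p /mapP[j]; rewrite mem_filter => /andP[Pj _] -> /=; split.
      exact/in_fock_scale/phi_fock.
    exact: n_particleZ.
  - rewrite big_map big_filter; under eq_bigr => j _ do rewrite (wE _ (fun=> 1)) ?mulr1 //.
    by rewrite -rmorph_sum w1.
  - rewrite big_map big_filter -wn rmorph_sum; apply: eq_bigr => j _.
    rewrite (wE _ (fun=> 1)) // mulr1 rmorphM /= mulrC; congr (_ * _).
    by rewrite /nuR rmorph_nat.
  - rewrite big_map big_filter rmorph_sum; apply: eq_bigr => j _.
    exact: wE.
have [w fw _] := to_weights _ ee.
have [w0 fw0 w0min] := feasible_min eps (ex_intro _ w fw).
exists (\sum_(j | P j) w0 j * eps j); split; first exact: of_weights.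
by move=> f /to_weights[w' fw' <-]; apply: w0min.
Qed.

End Hamiltonian.

(** * Locality, number conservation and hermiticity of the Hamiltonian *)

Section Assembly.
Variables (t : 'M[R]_r) (v : 'I_r -> 'I_r -> 'I_r -> 'I_r -> R).
Local Notation H := (hamiltonian (usubmx U) t v).

Lemma hamiltonianE : H = \sum_a \sum_c (t a c)%:C *: (bd (loc a) *m b (loc c))
  + 4^-1 *: \sum_a1 \sum_a2 \sum_c1 \sum_c2 (v a1 a2 c1 c2)%:C *:
    (bd (loc a1) *m bd (loc a2) *m b (loc c2) *m b (loc c1)).
Proof.
rewrite /hamiltonian; congr (_ + _ *: _).
  by do 2!(apply: eq_bigr => ? _); rewrite !row_loc.
by do 4!(apply: eq_bigr => ? _); rewrite !row_loc.
Qed.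

Lemma local_op_hamiltonian : local_op U H.
Proof.
rewrite hamiltonianE; apply: local_opD.
  by do 2!(apply: local_op_sum => ?); apply: local_opZ; apply: (local_op_cre_ann Uunit).
apply: local_opZ; do 4!(apply: local_op_sum => ?); apply: local_opZ.
exact: (local_op_quartic Uunit).
Qed.

Lemma number_op_hamiltonian : comm_mx number_op H.
Proof.
apply: comm_mxD.
  do 2!(apply: comm_mx_sum => ? _); apply/comm_mx_sym/comm_mxZl/comm_mx_sym.
  exact: number_op_comm_cre_ann.
apply/comm_mx_sym/comm_mxZl/comm_mx_sym.
do 4!(apply: comm_mx_sum => ? _); apply/comm_mx_sym/comm_mxZl/comm_mx_sym.
exact: number_op_comm_quartic.
Qed.

Lemma hamiltonianJ : t^T = t -> two_body_sym v -> H^t* = H.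
Proof.
move=> tT vs; rewrite adjmxD adjmxZ; congr (_ + _).
  rewrite adjmx_sum; under eq_bigr => a _ do rewrite adjmx_sum.
  rewrite exchange_big; apply: eq_bigr => a _; apply: eq_bigr => c _.
  rewrite adjmxZ adjmxM annK -[in RHS]tT mxE; congr (_ *: _).
  exact: conjc_real.
congr (_ *: _); first by rewrite fmorphV rmorph_nat.
rewrite [RHS](sum4_swap (fun a1 a2 c1 c2 => (v a1 a2 c1 c2)%:C *: _)).
rewrite adjmx_sum; apply: eq_bigr => a1 _; rewrite adjmx_sum; apply: eq_bigr => a2 _.
rewrite adjmx_sum; apply: eq_bigr => c1 _; rewrite adjmx_sum; apply: eq_bigr => c2 _.
rewrite adjmxZ !adjmxM !annK !mulmxA; have [<- _ _] := vs a1 a2 c1 c2.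
by congr (_ *: _); apply: conjc_real.
Qed.

End Assembly.
End GroundState.

(** * From the reduced pair to an ensemble in the Fock space of [V] *)

Section Representable.
Context {R : realType} {r s : nat} (U V : 'M[R[i]]_(r + s)).
Hypotheses (Uunit : U \is unitarymx) (UV : (usubmx U == V)%MS).
Local Notation d := (r + s)%N.
Local Notation b k := (ann (row k U)).
Local Notation bd k := (cre (row k U)).
Local Notation env j := (rshift r j).
Local Notation loc a := (lshift s a).

Variables (N k : nat) (x : 'I_k -> R) (psi : 'I_k -> ket R d).
Variable G : 'I_d -> 'I_d -> 'I_d -> 'I_d -> R[i].
Hypothesis N2 : (2 <= N)%N.
Hypothesis wx : weights x.
Hypothesis npsi : forall i, normalized (psi i) /\ n_particle N (psi i).
Hypothesis GE : forall al be ga de, G al be ga de =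
  \sum_(i < k) (x i)%:C * expect (bd al *m bd be *m b de *m b ga) (psi i).

(** Summing over the full basis turns the inner pair of operators into the number operator. It acts
    on a vector with [N.-1] particles, and the resulting factor cancels the normalisation, which is
    nonzero since [N] is at least 2. *)
Lemma sub_rhoE a c :
  sub_rho N G a c = \sum_i (x i)%:C * expect (bd (loc a) *m b (loc c)) (psi i).
Proof.
have N1 : N%:R - 1 = N.-1%:R :> R[i] by case: N N2 => // n _; rewrite -natr1 addrK.
have N0 : N.-1%:R != 0 :> R[i] by rewrite pnatr_eq0; case: N N2 => [|[]].
rewrite mxE N1; under eq_bigr => be _ do rewrite GE.
rewrite exchange_big mulr_sumr; apply: eq_bigr => i _ /=.
rewrite -mulr_sumr mulrCA; congr (_ * _); rewrite -expect_sum.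
have -> : \sum_be bd (loc a) *m bd be *m b be *m b (loc c) =
    bd (loc a) *m number_op *m b (loc c).
  rewrite (number_op_unitary Uunit) -mulmxA mulmx_suml mulmx_sumr.
  by apply: eq_bigr => be _; rewrite !mulmxA.
have /n_particleP np : n_particle N.-1 (b (loc c) *m psi i).
  by apply: n_particle_ann; case: (npsi i).
rewrite /expect -!mulmxA np -!scalemxAr mxE mulrA mulVf // mul1r.
by rewrite !mulmxA.
Qed.

Definition local_number : fock_op R d := \sum_a bd (loc a) *m b (loc a).

Lemma trace_sub_rho :
  \tr (sub_rho N G) = \sum_i (x i)%:C * expect local_number (psi i).
Proof.
rewrite /mxtrace; under eq_bigr do rewrite sub_rhoE.
by rewrite exchange_big; apply: eq_bigr => i _; rewrite /= expect_sum mulr_sumr.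
Qed.

Lemma energyE (t : 'M[R]_r) v :
  Tr1 (sub_rho N G) t + Tr2 (sub_Gamma G) v =
  \sum_i (x i)%:C * expect (hamiltonian (usubmx U) t v) (psi i).
Proof.
under [RHS]eq_bigr => i _ do rewrite hamiltonianE expectD mulrDr.
rewrite big_split /=; congr (_ + _).
  rewrite /Tr1.
  under [RHS]eq_bigr => i _ do (rewrite expect_sum mulr_sumr;
    under eq_bigr => a _ do rewrite expect_sum mulr_sumr).
  rewrite [RHS]exchange_big; apply: eq_bigr => a _ /=.
  rewrite [RHS]exchange_big; apply: eq_bigr => c _ /=.
  rewrite sub_rhoE mulr_suml; apply: eq_bigr => i _.
  by rewrite expectZ mulrAC mulrA.
rewrite /Tr2; under [RHS]eq_bigr => i _ do rewrite expectZ mulrCA.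
rewrite -mulr_sumr; congr (_ * _).
under [RHS]eq_bigr => i _ do (rewrite expect_sum mulr_sumr;
  under eq_bigr => a _ do (rewrite expect_sum mulr_sumr;
  under eq_bigr => a2 _ do (rewrite expect_sum mulr_sumr;
  under eq_bigr => c1 _ do rewrite expect_sum mulr_sumr))).
rewrite [RHS]exchange_big; apply: eq_bigr => a1 _ /=.
rewrite [RHS]exchange_big; apply: eq_bigr => a2 _ /=.
rewrite [RHS]exchange_big; apply: eq_bigr => c1 _ /=.
rewrite [RHS]exchange_big; apply: eq_bigr => c2 _ /=.
rewrite /sub_Gamma GE mulr_suml; apply: eq_bigr => i _.
by rewrite expectZ mulrAC mulrA.
Qed.

Lemma local_numberJ : local_number^t* = local_number.
Proof.
by rewrite adjmx_sum; apply: eq_bigr => a _; rewrite adjmxM annK.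
Qed.

Lemma reduced_ensemble (t : 'M[R]_r) v (Nbar e : R) :
  \tr (sub_rho N G) = Nbar%:C ->
  Tr1 (sub_rho N G) t + Tr2 (sub_Gamma G) v = e%:C ->
  ensemble_energy V (hamiltonian (usubmx U) t v) Nbar e.
Proof.
rewrite trace_sub_rho energyE => hN he.
have [x0 x1] := wx.
(* The weights are absorbed into the vectors, as [ensemble_of_seq] expects. *)
pose L := [seq (N, (Num.sqrt (x i))%:C *: psi i) | i <- index_enum 'I_k].
have LE A : \sum_(q <- L) expect A q.2 = \sum_i (x i)%:C * expect A (psi i).
  rewrite big_map; apply: eq_bigr => i _; rewrite expect_scale.
  rewrite [X in X * _ * _](_ : _ = (Num.sqrt (x i))%:C); last exact: conjc_real.
  by rewrite -rmorphM /= -expr2 sqr_sqrtr.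
have Ln : {in L, forall q, n_particle q.1 q.2}.
  by move=> q /mapP[i _ ->]; apply: n_particleZ; case: (npsi i).
have [L' [nL' kL' sL']] := env_split Uunit (enum 'I_s) Ln.
apply: (@ensemble_of_seq _ _ _ _ _ _ L').
- move=> q qL; split; last exact: nL'.
  by apply: (killed_in_fock Uunit UV) => j; apply: kL'; rewrite ?mem_enum.
- rewrite sL'; last exact: local_op1.
  rewrite LE; transitivity (\sum_i x i)%:C; last by rewrite x1.
  rewrite rmorph_sum; apply: eq_bigr => i _.
  by rewrite expect_normalized ?mulr1 //; case: (npsi i).
- rewrite -hN -LE -sL'; last first.
    by apply: local_op_sum => a; apply: (local_op_cre_ann Uunit).
  rewrite big_seq [RHS]big_seq; apply: eq_bigr => q qL.
  have /n_particleP/expect_eq <- := nL' q qL.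
  (* On vectors killed by all environment modes the total number operator has the same expectation
     as that of [V], so the definite particle numbers average to [Nbar]. *)
  rewrite (number_op_unitary Uunit) big_split_ord expectD /= [X in _ + X](_ : _ = 0) ?addr0 //.
  rewrite expect_sum big1 // => j _.
  by rewrite /expect -!mulmxA kL' ?mem_enum // !mulmx0 mxE.
- by rewrite -he -LE sL' //; apply: local_op_hamiltonian.
Qed.

End Representable.

(** * The energy inequality *)

Theorem theorem3 (R : realType) (r s N : nat)
    (V U : 'M[R[i]]_(r + s))
    (G : 'I_(r + s) -> 'I_(r + s) -> 'I_(r + s) -> 'I_(r + s) -> R[i]) :
  (2 <= N)%N ->
  U \is unitarymx ->
  (usubmx U == V)%MS ->
  N_representable U N G ->
  exists2 Nbar : R,
    \tr (sub_rho N G) = Nbar%:C &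
    forall (t : 'M[R]_r) (v : 'I_r -> 'I_r -> 'I_r -> 'I_r -> R),
      t^T = t ->
      two_body_sym v ->
      exists2 E0 : R,
        ground_energy V (hamiltonian (usubmx U) t v) Nbar E0 &
        E0%:C <= Tr1 (sub_rho N G) t + Tr2 (sub_Gamma G) v.
Proof.
move=> N2 Uunit UV [k [x [psi [wx npsi GE]]]].
(* Hermitian operators have real means: this supplies the real [Nbar], and a real energy to compare
   with [E0]. *)
have real_mean A : A^t* = A -> \sum_i (x i)%:C * expect A (psi i) =
    (\sum_i x i * complex.Re (expect A (psi i)))%:C.
  move=> AJ; rewrite rmorph_sum; apply: eq_bigr => i _.
  by rewrite rmorphM /= -expect_herm.
have trE := trace_sub_rho Uunit N2 npsi GE.
rewrite (real_mean _ (local_numberJ U)) in trE.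
exists (\sum_i x i * complex.Re (expect (local_number U) (psi i))) => // t v tT vs.
have HJ := hamiltonianJ U tT vs.
have enE := energyE Uunit N2 npsi GE t v; rewrite (real_mean _ HJ) in enE.
have ee := reduced_ensemble Uunit UV N2 wx npsi GE trE enE.
have [E0 gE0] := ground_energy_exists Uunit UV HJ
  (local_op_hamiltonian Uunit t v) (number_op_hamiltonian U t v) ee.
exists E0 => //; rewrite enE lecR.
by case: gE0 => _; apply.
Qed.
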